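(* Let $n\ge 6$ and let $L$ be a 3-uniform list assignment of $\Pi_n$. If $c$ is a lex-min $L$-coloring of $\Pi_n$, then $c$ is $\lceil 2n/3\rceil$-bounded, i.e. every color class of $c$ has at most $\lceil 2n/3\rceil$ vertices.
   Context: $\Pi_n=C_n\square K_2$ has vertices $u_1,\dots,u_n,v_1,\dots,v_n$ and edges $u_iu_{i+1}$, $v_iv_{i+1}$ (indices mod $n$) and $u_iv_i$. A 3-uniform list assignment gives each vertex a set $L(v)$ of exactly 3 colors; a proper $L$-coloring is a proper coloring with $c(v)\in L(v)$. For a proper $L$-coloring $c$ with nonempty color classes $C_1,\dots,C_r$ ordered so that $|C_1|\ge\cdots\ge|C_r|$, the color word is $w_c=n_1\cdots n_r$ with $n_i=|C_i|$. A lex-min $L$-coloring is a proper $L$-coloring $c$ such that for every proper $L$-coloring $c'$ with color word $m_1\cdots m_s$, either $w_c=w_{c'}$ or there is $k$ ($1\le k\le s$) with $n_i=m_i$ for $i<k$ and $n_k<m_k$. *)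

(* Defs.v *)
From mathcomp Require Import all_boot finmap.

Set Implicit Arguments.
Unset Strict Implicit.
Unset Printing Implicit Defensive.

(* Simple graphs are adjacency relations on a finType of vertices. *)

Definition cycle_graph (n : nat) : rel 'I_n :=
  fun i j => (j == ordS i) || (i == ordS j).

Definition complete_graph (T : finType) : rel T := fun x y => x != y.

Definition cartesian_product (S T : finType) (g : rel S) (h : rel T) :
    rel (S * T) :=
  fun x y => (x.1 == y.1) && h x.2 y.2 || g x.1 y.1 && (x.2 == y.2).

(* u_i and v_i are (i, false) and (i, true), with i ranging over 0, ..., n-1;
   cycle_graph n is the n-cycle only for n >= 3. *)
Definition prism (n : nat) : rel ('I_n * bool) :=
  cartesian_product (@cycle_graph n) (@complete_graph bool).

Section ListColoring.

Variables (V : finType) (C : choiceType).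
Implicit Types (e : rel V) (L : V -> {fset C}) (c : V -> C).

Definition uniform_list_assignment (k : nat) L : Prop :=
  forall v, #|` L v| = k.

Definition proper_coloring e c : Prop := forall x y, e x y -> c x != c y.

Definition proper_list_coloring e L c : Prop :=
  proper_coloring e c /\ forall v, c v \in L v.

Definition color_class c (a : C) : {set V} := [set v | c v == a].

(* Only colors in the image of c are listed, so every entry is positive. *)
Definition color_word c : seq nat :=
  sort geq [seq #|color_class c a| | a <- undup (codom c)].

(* Entries past the end read as 0.  Color words of colorings of the same graph
   have positive entries and equal sums, so neither is a proper prefix of the
   other and the default is never compared at the deciding index k. *)
Definition lex_lt (w w' : seq nat) : Prop :=
  exists2 k, k < size w' &
    (forall i, i < k -> nth 0 w i = nth 0 w' i) /\ nth 0 w k < nth 0 w' k.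

Definition lex_min_coloring e L c : Prop :=
  proper_list_coloring e L c /\
  forall c', proper_list_coloring e L c' ->
    color_word c = color_word c' \/ lex_lt (color_word c) (color_word c').

Definition bounded_coloring (b : nat) c : Prop :=
  forall a, #|color_class c a| <= b.

End ListColoring.

(* Ceiling of m / d, for d > 0. *)
Definition ceil_divn (m d : nat) : nat := (m + d.-1) %/ d.

(* Main.v *)
(* A color class of size m larger than 2n/3 rounded up can always be improved.
   If every other class has at most m - 2 vertices, any move that shrinks the
   large class and enlarges the others by at most one is an improvement.  The
   large class then meets three consecutive columns, and such a move is found by
   giving a vertex of the class the color of a neighbor on which that color
   occurs only once, and recoloring this neighbor.  Otherwise there is exactly
   one other class of size at least m - 1, and fewer than 2n/3 vertices lie
   outside these two classes.  But every vertex of the two classes must see an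
   outside vertex, and discharging over the columns shows that there are at
   least 2n/3 of those.  The only exception, class sizes m, m - 1, m - 2, forces
   all lists to be equal and 3 to divide n, and then the 3-coloring of period 3
   is better. *)

Require Import Defs.
From mathcomp Require Import all_boot finmap zify.

Set Implicit Arguments.
Unset Strict Implicit.
Unset Printing Implicit Defensive.

(* [lia] case-splits on every boolean and every hypothesis it can see. *)
Ltac count_lia :=
  repeat match goal with
  | |- context [nat_of_bool ?b] => move: (nat_of_bool b) => ?
  | |- context [card ?A] => move: (card A) => ?
  end; clear; lia.

(** * Color words and lexicographic comparison *)

(** Turns comparisons of word entries into counts of large classes. Positivity of [t] makes both
    sides false past the end, where [nth] reads 0. *)
Lemma sorted_geq_nth (w : seq nat) (t i : nat) :
  sorted geq w -> 0 < t -> (t <= nth 0 w i) = (i < count (leq t) w).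
Proof.
move=> w_sorted t_gt0; elim: w w_sorted i => [|x w IHw] /= w_sorted i.
  by rewrite nth_nil leqNgt t_gt0.
have w_le_x: all (geq x) w.
  by apply: order_path_min w_sorted => // ? ? ? /= *; lia.
case: i => [|i] /=; last first.
  rewrite (IHw (path_sorted w_sorted)).
  case: (leqP t x) => [_|x_lt_t]; first by rewrite add1n.
  suff -> : count (leq t) w = 0 by [].
  apply/eqP; rewrite -leqn0 leqNgt -has_count -all_predC.
  by apply: sub_all w_le_x => y /=; lia.
case: (leqP t x) => [_|x_lt_t] //=.
suff -> : count (leq t) w = 0 by [].
apply/eqP; rewrite -leqn0 leqNgt -has_count -all_predC.
by apply: sub_all w_le_x => y /=; lia.
Qed.

Lemma card3_avoid (C : choiceType) (l : {fset C}) (p q : C) :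
  #|` l| = 3 -> exists2 z, z \in l & (z != p) && (z != q).
Proof.
move=> l3; have : #|` l| > #|` [fset p; q]%fset|.
  by rewrite l3 cardfs2; case: (p != q).
move=> lt; case: (boolP (l `<=` [fset p; q])%fset) => [/fsubset_leq_card|].
  by rewrite leqNgt lt.
by case/fsubsetPn => z zl; rewrite !inE negb_or; exists z.
Qed.

Section Recolor.

Variables (V : finType) (C : choiceType).
Implicit Types (e : rel V) (L : V -> {fset C}) (c : V -> C).

Lemma color_class_gt0 c x : (0 < #|color_class c x|) = (x \in codom c).
Proof.
apply/card_gt0P/codomP => [[v]|[v ->]]; last by exists v; rewrite inE.
by rewrite inE => /eqP <-; exists v.
Qed.

Lemma count_color_word c t :
  count (leq t) (color_word c) =
  size [seq x <- undup (codom c) | t <= #|color_class c x|].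
Proof. by rewrite count_sort count_map size_filter. Qed.

Lemma color_word_sorted c : sorted geq (color_word c).
Proof. by apply: sort_sorted => x y /=; exact: leq_total. Qed.

(** For every [s >= t], [c'] has no more classes of size at least [s] than [c], and strictly fewer
    for [s = t] because of [a]. So the word of [c'] stays weakly below that of [c] until an index
    where it is strictly below. Classes smaller than [t] in [c'] are free to have grown. *)
Lemma lex_min_dominated e L c c' t a :
  lex_min_coloring e L c -> proper_list_coloring e L c' ->
  (forall x, t <= #|color_class c' x| ->
     #|color_class c' x| <= #|color_class c x|) ->
  #|color_class c' a| < t <= #|color_class c a| -> False.
Proof.
move=> [_ cmin] pc' dom /andP[a_lt a_ge].
have t_gt0: 0 < t by lia.
set w := color_word c; set w' := color_word c'.
have memc s x : t <= s -> x \in [seq x <- undup (codom c') | s <= #|color_class c' x|] ->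
    x \in [seq x <- undup (codom c) | s <= #|color_class c x|].
  move=> ts; rewrite !mem_filter !mem_undup => /andP[sx _].
  have xle : #|color_class c' x| <= #|color_class c x| by apply: dom; lia.
  by rewrite -color_class_gt0; apply/andP; split; lia.
have le_count s : t <= s -> count (leq s) w' <= count (leq s) w.
  move=> ts; rewrite !count_color_word; apply: uniq_leq_size.
    exact/filter_uniq/undup_uniq.
  by move=> x; apply: memc.
(* Exactly [k] entries of [w'] reach [t], so the entry at index [k] is below [t] in [w'], while in
   [w] it is at least [t]. *)
set k := count (leq t) w'.
have lt_count : k < count (leq t) w.
  rewrite /k !count_color_word.
  (* Adding [a] to the large colors of [c'] still gives distinct large colors of [c]. *)
  set r := [seq _ <- _ | _]; change (size (a :: r) <= size [seq x <- undup (codom c) | t <= #|color_class c x|]).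
  apply: uniq_leq_size => /= [|x].
    rewrite /r mem_filter leqNgt a_lt /=; exact/filter_uniq/undup_uniq.
  rewrite inE => /predU1P[->|]; last exact: memc.
  by rewrite mem_filter mem_undup a_ge -color_class_gt0; lia.
have at_k : nth 0 w' k < nth 0 w k.
  have H1 := sorted_geq_nth k (color_word_sorted c') t_gt0.
  have H2 := sorted_geq_nth k (color_word_sorted c) t_gt0.
  rewrite -/w lt_count in H2; rewrite -/w' ltnn in H1; lia.
have before i : i < k -> nth 0 w' i <= nth 0 w i.
  move=> ik; have t_le : t <= nth 0 w' i.
    by rewrite (sorted_geq_nth _ (color_word_sorted c')).
  rewrite (sorted_geq_nth _ (color_word_sorted c)); last by lia.
  apply: leq_trans (le_count _ t_le).
  by rewrite -(sorted_geq_nth _ (color_word_sorted c')) //; lia.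
case: (cmin _ pc') => [eqw|[j _ [eq_lt lt_j]]].
  by move: at_k; rewrite /w /w' eqw ltnn.
case: (ltngtP j k) => [jk|kj|jk].
- by move: (before _ jk); rewrite leqNgt lt_j.
- by move: at_k; rewrite /w (eq_lt _ kj) ltnn.
- by move: at_k; rewrite -jk ltnNge ltnW.
Qed.

(** * Recoloring moves, and what follows when they are blocked *)

Definition recolor c v x : V -> C := fun u => if u == v then x else c u.

(** The additive form avoids truncated subtraction and also covers [x = c v], where the two
    corrections cancel. *)
Lemma card_recolor c v x y :
  #|color_class (recolor c v x) y| + (c v == y) =
  #|color_class c y| + (x == y).
Proof.
rewrite (cardsD1 v) (cardsD1 v (color_class c y)) !inE /recolor eqxx.
suff -> : color_class (fun u => if u == v then x else c u) y :\ v =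
          color_class c y :\ v by lia.
by apply/setP => u; rewrite !inE; case: eqP.
Qed.

(** Only recolored vertices need checking: by symmetry, one recolored endpoint settles an edge, and
    edges without one inherit properness from [c]. *)
Lemma proper_list_coloring_local e L c c' :
  symmetric e -> proper_list_coloring e L c ->
  (forall u, c' u = c u \/
     c' u \in L u /\ forall t, e u t -> c' t != c' u) ->
  proper_list_coloring e L c'.
Proof.
move=> e_sym [pc cL] loc; split=> [u t ut|u].
  case: (loc u) => [eu|[_ Hu]]; last by rewrite eq_sym Hu.
  case: (loc t) => [et|[_ Ht]]; last by rewrite Ht // e_sym.
  by rewrite eu et pc.
by case: (loc u) => [->|[]].
Qed.

(* [stuck] is what lex-minimality gives when [d] is a largest class (or one of
   two) and every color satisfying [ok] is small enough to gain a vertex. *)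
Section Blocked.

Variables (e : rel V) (L : V -> {fset C}) (c : V -> C) (d : C) (ok : pred C).
Hypothesis e_sym : symmetric e.
Hypothesis pc : proper_list_coloring e L c.
Hypothesis stuck : forall c' z, proper_list_coloring e L c' -> z != d -> ok z ->
  (forall x, #|color_class c' x| <= #|color_class c x| + (x == z)) ->
  #|color_class c' d| < #|color_class c d| -> False.

Lemma neighbor_colored v y : c v = d -> y \in L v -> y != d -> ok y ->
  exists2 u, e v u & c u = y.
Proof.
move=> cv yL yd oky.
case: (boolP [exists u, e v u && (c u == y)]) => [/existsP[u /andP[vu /eqP]]|].
  by exists u.
move=> /existsPn no; exfalso; apply: (stuck (c' := recolor c v y) (z := y)) => //.
- apply: (proper_list_coloring_local e_sym pc) => u; rewrite {1 2}/recolor.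
  case: eqP => [->|]; [right; split=> // t vt|by left].
  rewrite /recolor eqxx; case: (t =P v) => [tv|_].
    by have := pc.1 _ _ vt; rewrite tv eqxx.
  by have := no t; rewrite vt.
- by move=> x; have := card_recolor c v y x; rewrite (eq_sym x); count_lia.
- by have := card_recolor c v y d; rewrite cv eqxx (negPf yd); lia.
Qed.

(** If no neighbor of [w] had color [z], then [w] could take [z] and pass its old color to [v]. The
    class of [d] loses [v], that of [z] gains [w], and that of [c w] keeps its size. *)
Lemma private_neighbor_stuck v w z : c v = d -> e v w -> c w \in L v ->
  (forall u, e v u -> c u = c w -> u = w) ->
  z \in L w -> z != c w -> z != d -> ok z -> exists2 u, e w u & c u = z.
Proof.
move=> cv vw cwL priv zL zw zd okz.
case: (boolP [exists u, e w u && (c u == z)]) => [/existsP[u /andP[wu /eqP]]|].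
  by exists u.
move=> /existsPn no; exfalso.
have cwd : c w != d by rewrite -cv eq_sym (pc.1 _ _ vw).
have vNw : (v == w) = false by apply/negbTE; apply: contraNneq cwd => <-; rewrite cv.
apply: (stuck (c' := recolor (recolor c w z) v (c w)) (z := z)) => //.
- apply: (proper_list_coloring_local e_sym pc) => u; rewrite {1 2}/recolor.
  case: (u =P v) => [->|uv].
    right; rewrite {1}/recolor eqxx; split=> // t vt; rewrite /recolor eqxx.
    case: (t =P v) => [tv|tv]; first by have := pc.1 _ _ vt; rewrite tv eqxx.
    case: (t =P w) => // tw; apply/eqP => ct; exact: tw (priv _ vt ct).
  rewrite /recolor; case: (u =P w) => [->|uw]; last by left.
  rewrite [w == v]eq_sym vNw; right; split=> // t wt.
  case: (t =P v) => [tv|tv]; first by rewrite eq_sym.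
  case: (t =P w) => [tw|tw]; first by have := pc.1 _ _ wt; rewrite tw eqxx.
  by have := no t; rewrite wt.
- move=> x; have := card_recolor (recolor c w z) v (c w) x.
  have := card_recolor c w z x; rewrite [recolor c w z v]/recolor vNw (eq_sym x); count_lia.
- have := card_recolor (recolor c w z) v (c w) d.
  have := card_recolor c w z d; rewrite [recolor c w z v]/recolor vNw cv eqxx.
  rewrite (negPf zd) (negPf cwd) /=; count_lia.
Qed.

(** Swap colors: [w] takes [d], while [v] and [v'] take the old color of [w]. The net effect is
    minus one for [d] and plus one for [c w]. *)
Lemma two_private_stuck w v v' : v != v' ->
  c v = d -> e w v -> c w \in L v -> (forall u, e v u -> c u = c w -> u = w) ->
  c v' = d -> e w v' -> c w \in L v' ->
  (forall u, e v' u -> c u = c w -> u = w) ->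
  (forall u, e w u -> c u = d -> u = v \/ u = v') ->
  d \in L w -> ok (c w) -> False.
Proof.
move=> vv' cv wv wL priv cv' wv' wL' priv' only dL okw.
have cwd : c w != d by rewrite -cv (pc.1 _ _ wv).
have vNw : (v == w) = false by apply/negbTE; apply: contraNneq cwd => <-; rewrite cv.
have v'Nw : (v' == w) = false by apply/negbTE; apply: contraNneq cwd => <-; rewrite cv'.
have v'Nv : (v' == v) = false by rewrite eq_sym (negPf vv').
have col u : recolor (recolor (recolor c w d) v (c w)) v' (c w) u =
    if u == v' then c w else if u == v then c w else if u == w then d else c u by [].
have wNv : (w == v) = false by rewrite eq_sym.
have wNv' : (w == v') = false by rewrite eq_sym.
have cvv' : forall t, (e v t \/ e v' t) -> (t == v') = false /\ (t == v) = false.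
  move=> t H; have : c t != d.
    by case: H => /(pc.1); rewrite ?cv ?cv' eq_sym.
  by move=> ctd; split; apply/negbTE; apply: contraNneq ctd => ->; rewrite ?cv ?cv'.
apply: (stuck (c' := recolor (recolor (recolor c w d) v (c w)) v' (c w)) (z := c w)) => //.
- apply: (proper_list_coloring_local e_sym pc) => u.
  have [->|uv'] := eqVneq u v'; [right|have [->|uv] := eqVneq u v; [right|
    have [->|uw] := eqVneq u w; [right|left]]];
    rewrite !col ?eqxx ?(negPf vv') ?wNv ?wNv' ?(negPf uv') ?(negPf uv) ?(negPf uw) //;
    split=> // t et; rewrite col.
  + have [-> ->] := cvv' t (or_intror et).
    case: (t =P w) => [_|tw]; first by rewrite eq_sym.
    by apply/eqP => ct; exact: tw (priv' _ et ct).
  + have [-> ->] := cvv' t (or_introl et).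
    case: (t =P w) => [_|tw]; first by rewrite eq_sym.
    by apply/eqP => ct; exact: tw (priv _ et ct).
  + case: (t =P v') => // tv'; case: (t =P v) => // tv.
    case: (t =P w) => [tw|_]; first by have := pc.1 _ _ et; rewrite tw eqxx.
    by apply/eqP => ct; case: (only _ et ct).
- move=> x; have := card_recolor (recolor (recolor c w d) v (c w)) v' (c w) x.
  have := card_recolor (recolor c w d) v (c w) x.
  have := card_recolor c w d x.
  rewrite [recolor _ v _ v']/recolor [recolor c w d v']/recolor [recolor c w d v]/recolor v'Nv v'Nw vNw cv cv' (eq_sym x); count_lia.
- have := card_recolor (recolor (recolor c w d) v (c w)) v' (c w) d.
  have := card_recolor (recolor c w d) v (c w) d.
  have := card_recolor c w d d.
  rewrite [recolor _ v _ v']/recolor [recolor c w d v']/recolor [recolor c w d v]/recolor v'Nv v'Nw vNw cv cv' eqxx (negPf cwd) /=; count_lia.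
Qed.

End Blocked.
End Recolor.

(** * Columns, rotations and neighbors in the prism *)

Section Prism.

Variable n : nat.
Implicit Types (i : 'I_n) (b s : bool).

(** A direction is a boolean, reversed by [~~], so that mirror-image cases share one argument. *)
Definition turn b : 'I_n -> 'I_n := if b then @ordS n else @ord_pred n.

Lemma turnK b : cancel (turn b) (turn (~~ b)).
Proof. by case: b; [exact: ordSK | exact: ord_predK]. Qed.

Lemma val_turn b i : turn b i =
  (if b then (if i.+1 == n then 0 else i.+1)
   else (if i == 0 :> nat then n.-1 else i.-1)) :> nat.
Proof.
have := ltn_ord i; case: b => /= i_lt.
  by case: eqP => [->|ne]; rewrite ?modnn // modn_small; lia.
case: eqP => [->|ne]; first by rewrite add0n modn_small; lia.
have -> : (i + n).-1 = i.-1 + n by lia.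
by rewrite modnDr modn_small; lia.
Qed.

Lemma turn_neq b i : 5 <= n ->
  uniq [:: i; turn b i; turn (~~ b) i; turn b (turn b i);
           turn (~~ b) (turn (~~ b) i)].
Proof.
move=> n_ge5; rewrite /= !inE -!val_eqE /= !val_turn; have := ltn_ord i.
by case: b => /=; do !case: ifP => ?; lia.
Qed.

Lemma prismE b i s (u : 'I_n * bool) : prism (i, s) u =
  [|| u == (turn b i, s), u == (turn (~~ b) i, s) | u == (i, ~~ s)].
Proof.
case: u => j t; rewrite /prism /cartesian_product /cycle_graph /complete_graph /=.
rewrite !xpair_eqE.
have -> : (i == ordS j) = (j == ord_pred i).
  by apply/eqP/eqP => ->; rewrite ?ordSK ?ord_predK.
rewrite (eq_sym i j); case: b; rewrite /turn /=;
  by case: s t => [] []; rewrite ?andbT ?andbF ?orbF //= orbC.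
Qed.

Lemma prism_sym : symmetric (@prism n).
Proof.
move=> [i s] [j t]; rewrite /prism /cartesian_product /cycle_graph /complete_graph /=.
by rewrite (eq_sym i j) (eq_sym s t) (orbC (j == _)).
Qed.

Lemma prism_neighborP b i s (u : 'I_n * bool) : prism (i, s) u ->
  [\/ u = (turn b i, s), u = (turn (~~ b) i, s) | u = (i, ~~ s)].
Proof.
by rewrite (prismE b) => /or3P[] /eqP->; [constructor 1|constructor 2|constructor 3].
Qed.

Lemma prism_turn b i s : prism (i, s) (turn b i, s).
Proof. by rewrite (prismE b) eqxx. Qed.

Lemma prism_rung i s : prism (i, s) (i, ~~ s).
Proof. by rewrite (prismE true) eqxx !orbT. Qed.

Lemma card_columns (P : pred ('I_n * bool)) :
  #|[set v | P v]| = \sum_i (P (i, false) + P (i, true)).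
Proof.
rewrite cardsE -sum1_card big_mkcond /=.
rewrite (eq_bigr (fun v : 'I_n * bool => nat_of_bool (P (v.1, v.2)))); last first.
  by case=> i s _; rewrite unfold_in; case: (P _).
rewrite -(pair_bigA _ (fun i s => nat_of_bool (P (i, s)))) /=.
by apply: eq_bigr => i _; rewrite big_bool addnC.
Qed.

Variables (C : choiceType) (L : 'I_n * bool -> {fset C}) (c : 'I_n * bool -> C).
Hypothesis n_ge5 : 5 <= n.
Hypothesis L3 : uniform_list_assignment 3 L.
Hypothesis pc : proper_list_coloring (@prism n) L c.

(** * One dominant class: it cannot meet three consecutive columns *)

Section ThreeConsecutive.

Variable d : C.
Hypothesis stuck : forall c' z, proper_list_coloring (@prism n) L c' ->
  z != d ->
  (forall x, #|color_class c' x| <= #|color_class c x| + (x == z)) ->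
  #|color_class c' d| < #|color_class c d| -> False.

Let stuckT c' z : proper_list_coloring (@prism n) L c' -> z != d -> @predT C z ->
  (forall x, #|color_class c' x| <= #|color_class c x| + (x == z)) ->
  #|color_class c' d| < #|color_class c d| -> False.
Proof. by move=> pc' zd _; exact: stuck pc' zd. Qed.

(** All neighbors of the center [(i, ~~ s)] have color [d], so it can be recolored easily. Blocking
    the moves makes the color of some [(j, s)] beside [(i, s)] private to [(i, s)]; then a move at
    [(j, ~~ s)] succeeds, using either the center or [(j, s)]. *)
Lemma no_three_consecutive i s :
  c (i, s) = d -> (forall b, c (turn b i, ~~ s) = d) -> False.
Proof.
move=> cis cturn.
have colored := neighbor_colored prism_sym pc stuckT.
have private := private_neighbor_stuck prism_sym pc stuckT.
(* A color of the center's list other than [d] and its own is free there, so the center's color can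
   never be private to a neighbor that may take it. *)
have center_private v : prism (i, ~~ s) v -> c (i, ~~ s) \in L v ->
    (forall u, prism v u -> c u = c (i, ~~ s) -> u = (i, ~~ s)) -> False.
  have all_d u : prism (i, ~~ s) u -> c u = d.
    by case/(prism_neighborP true) => -> //; rewrite negbK.
  move=> wv cL priv.
  have [z zL /andP[zw zd]] := card3_avoid (c (i, ~~ s)) d (L3 (i, ~~ s)).
  have [] := private v (i, ~~ s) z => //; first exact: all_d.
    by rewrite prism_sym.
  by move=> u /all_d -> dz; rewrite dz eqxx in zd.
(* A list color of [(i, s)] that is neither [d] nor the center's color must occur on a side. If it
   occurs on both, a third list color can only occur at the center, where it is private. *)
have [b [zL priv]] : exists b, c (turn b i, s) \in L (i, s) /\
    forall u, prism (i, s) u -> c u = c (turn b i, s) -> u = (turn b i, s).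
  have [z zL /andP[zd zx]] := card3_avoid d (c (i, ~~ s)) (L3 (i, s)).
  have [u au cu] := colored _ _ cis zL zd isT.
  have [b ub] : exists b, u = (turn b i, s).
    case/(prism_neighborP true): au cu => -> cu; [by exists true|by exists false|].
    by rewrite cu eqxx in zx.
  have cNb : c (turn (~~ b) i, s) <> z.
    move=> cNb.
    have [z' z'L /andP[z'd z'z]] := card3_avoid d z (L3 (i, s)).
    have [u' au' cu'] := colored _ _ cis z'L z'd isT.
    case/(prism_neighborP b): au' cu' => ->.
    - by rewrite -ub cu => zz'; rewrite zz' eqxx in z'z.
    - by rewrite cNb => zz'; rewrite zz' eqxx in z'z.
    - move=> cz'; apply: (center_private (i, s)).
      + by rewrite prism_sym prism_rung.
      + by rewrite cz'.
      + move=> t /(prism_neighborP b)[] -> //; rewrite cz' ?cNb -?ub ?cu => zz';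
        by rewrite zz' eqxx in z'z.
  exists b; rewrite -ub cu; split=> // t /(prism_neighborP b)[] -> //.
  by move=> cz; rewrite cz eqxx in zx.
set j := turn b i in zL priv *.
have ji : turn (~~ b) j = i by rewrite /j turnK.
have cjs : c (j, ~~ s) = d by exact: cturn.
have cw01 : c (i, ~~ s) != c (j, s).
  by apply/eqP => E; case: (priv _ (prism_rung i s) E) => _; case: (s).
have is_js : prism (i, s) (j, s) by exact: prism_turn.
have w1_nbr u : prism (j, s) u ->
    [\/ u = (turn b j, s), u = (i, s) | u = (j, ~~ s)].
  by move/(prism_neighborP b); rewrite ji.
have a1_nbr u : prism (j, ~~ s) u ->
    [\/ u = (turn b j, ~~ s), u = (i, ~~ s) | u = (j, s)].
  by move/(prism_neighborP b); rewrite ji negbK.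
(* Otherwise [(j, s)] would see only [d] and could be recolored, releasing its private color to
   [(i, s)]. *)
have ct : c (turn b j, s) != d.
  apply/eqP => ct.
  have [z' z'L /andP[z'w z'd]] := card3_avoid (c (j, s)) d (L3 (j, s)).
  have [u /w1_nbr wu cu] := private (i, s) (j, s) z' cis is_js zL priv z'L z'w z'd isT.
  by case: wu cu => ->; rewrite ?ct ?cis ?cjs => E; rewrite E eqxx in z'd.
(* A list color of [(j, s)] avoiding its own color and that of its outer neighbor would be free
   there unless it is [d]. *)
have dL : d \in L (j, s).
  have [z' z'L /andP[z'w z't]] := card3_avoid (c (j, s)) (c (turn b j, s)) (L3 (j, s)).
  have [<- //|z'd] := eqVneq z' d.
  have [u /w1_nbr wu cu] := private (i, s) (j, s) z' cis is_js zL priv z'L z'w z'd isT.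
  by case: wu cu => ->; rewrite ?cis ?cjs => E; rewrite E eqxx in z'd z't.
have i_js : prism (i, ~~ s) (j, ~~ s) by exact: prism_turn.
have [x_in|x_out] := boolP ((c (i, ~~ s) \in L (j, ~~ s)) &&
                            (c (turn b j, ~~ s) != c (i, ~~ s))).
  case/andP: x_in => xL xw2; apply: (center_private (j, ~~ s)) => //.
  move=> u /a1_nbr[] -> // E; first by rewrite E eqxx in xw2.
  by rewrite E eqxx in cw01.
have [zL1 zw2] : c (j, s) \in L (j, ~~ s) /\ c (turn b j, ~~ s) != c (j, s).
  have step p : (forall z', z' \in L (j, ~~ s) -> z' != d -> z' != p ->
      z' = c (i, ~~ s) /\ c (turn b j, ~~ s) != c (i, ~~ s)) -> False.
    move=> H; have [z' z'L /andP[z'd z'p]] := card3_avoid d p (L3 (j, ~~ s)).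
    have [E w2] := H z' z'L z'd z'p.
    by case/negP: x_out; rewrite -{1}E z'L w2.
  have [zw2|zw2] := eqVneq (c (turn b j, ~~ s)) (c (j, s)).
    exfalso; apply: (step (c (j, s))) => z' z'L z'd z'p; rewrite zw2 eq_sym; split=> //.
    have [u /a1_nbr au cu] := colored _ _ cjs z'L z'd isT.
    by case: au cu => ->; rewrite ?zw2 => E //; rewrite E eqxx in z'p.
  have [//|zNL] := boolP (c (j, s) \in L (j, ~~ s)).
  exfalso; apply: (step (c (turn b j, ~~ s))) => z' z'L z'd z'p.
  have [u /a1_nbr au cu] := colored _ _ cjs z'L z'd isT.
  case: au cu => -> E; first by rewrite E eqxx in z'p.
    by rewrite E eq_sym.
  by rewrite E z'L in zNL.
apply: (two_private_stuck prism_sym pc stuckT (w := (j, s)) (v := (i, s))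
          (v' := (j, ~~ s))) => //.
- by rewrite xpair_eqE negb_and; case: (s) => /=; rewrite orbT.
- by rewrite prism_sym.
- exact: prism_rung.
- move=> u /a1_nbr[] -> // E; first by rewrite E eqxx in zw2.
  by rewrite E eqxx in cw01.
- move=> u /w1_nbr[] -> E; [by rewrite E eqxx in ct|by left|by right].
Qed.

Lemma stuck_class_small : 3 * #|color_class c d| <= 2 * n.
Proof.
pose h i := (c (i, false) == d) + (c (i, true) == d).
have h_le1 i : h i <= 1.
  have := pc.1 _ _ (prism_rung i false); rewrite /h.
  case: (c (i, false) =P d) => [->|_] /=; last by case: (_ == d).
  by rewrite eq_sym => /negPf ->.
(* Three hits in three consecutive columns are one per column, and properness makes them alternate
   sides, which is the excluded configuration. *)
have h3 i : h (turn false i) + h i + h (turn true i) <= 2.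
  have [|le1] := ltnP 2 (h (turn false i) + h i + h (turn true i)); last by [].
  move=> ge3; exfalso.
  have h1 := h_le1 (turn false i); have h2 := h_le1 i; have h4 := h_le1 (turn true i).
  have hs j : h j = 1 -> exists s, c (j, s) = d.
    rewrite /h; case: eqP => [<-|_]; first by exists false.
    by case: eqP => // <- _; exists true.
  have [s cs] : exists s, c (i, s) = d by apply: hs; lia.
  apply: (no_three_consecutive cs) => b.
  have [s' cs'] : exists s', c (turn b i, s') = d by apply: hs; case: (b); lia.
  have := pc.1 _ _ (prism_turn b i s); rewrite cs -cs'.
  by case: (s) (s') => [] [] //; rewrite eqxx.
have shift b : \sum_i h (turn b i) = \sum_i h i.
  by rewrite [RHS](reindex_inj (can_inj (turnK b))).
have -> : #|color_class c d| = \sum_i h i by exact: card_columns.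
have : \sum_i (h (turn false i) + h i + h (turn true i)) <= \sum_(i < n) 2.
  by apply: leq_sum => i _; exact: h3.
rewrite 2!big_split !shift sum_nat_const card_ord.
by move: (\sum_i h i) => S /=; clear; lia.
Qed.

End ThreeConsecutive.
End Prism.

Arguments turn : simpl never.

(** * Two large classes: discharging over the columns *)

Section TwoLargeClasses.

Variables (n : nat) (C : choiceType).
Variables (L : 'I_n * bool -> {fset C}) (c : 'I_n * bool -> C).
Hypothesis n_ge5 : 5 <= n.
Hypothesis L3 : uniform_list_assignment 3 L.
Hypothesis pc : proper_list_coloring (@prism n) L c.

Variables (d1 d2 : C) (m : nat).
Hypothesis d12 : d1 != d2.

Definition big : pred C := fun x => (x == d1) || (x == d2).

Hypothesis stuck : forall d c' z, big d -> proper_list_coloring (@prism n) L c' ->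
  z != d -> ~~ big z ->
  (forall x, #|color_class c' x| <= #|color_class c x| + (x == z)) ->
  #|color_class c' d| < #|color_class c d| -> False.
Hypothesis big_le : forall x, big x -> #|color_class c x| <= m.
Hypothesis small_le : forall x, ~~ big x -> #|color_class c x| + 3 <= m.
Hypothesis no_smaller : forall c', proper_list_coloring (@prism n) L c' ->
  (forall x, #|color_class c' x| < m) -> False.

Lemma big_neighbor_colored v y : big (c v) -> y \in L v -> ~~ big y ->
  exists2 u, prism v u & c u = y.
Proof.
move=> bv yL yb.
apply: (neighbor_colored (ok := fun z => ~~ big z) (@prism_sym n) pc _ erefl) => //.
  by move=> c' z pc' zd okz; exact: stuck pc' zd okz.
by apply: contraNneq yb => ->.
Qed.

(** A list of three colors contains one outside the two big ones; it must occur next to [v], or [v]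
    could take it. *)
Lemma big_has_small_neighbor v : big (c v) -> exists2 u, prism v u & ~~ big (c u).
Proof.
move=> bv; have [z zL z12] := card3_avoid d1 d2 (L3 v).
rewrite -negb_or in z12; have [u vu cu] := big_neighbor_colored bv zL z12.
by exists u => //; rewrite cu.
Qed.

(* The vertex (i, s) and its neighbor's neighbor (turn true i, ~~ s) get d while
   the three neighbors of (i, s) get y: the classes of d and e lose one vertex
   and that of y gains two. *)
Lemma reduce_around_small i s d e y :
  d != e -> big d -> big e -> ~~ big y ->
  c (i, s) = y -> c (i, ~~ s) = d ->
  (forall r, c (turn r i, s) = d /\ c (turn r i, ~~ s) = e) ->
  ~~ big (c (turn true (turn true i), ~~ s)) ->
  d \in L (turn true i, ~~ s) -> d \in L (i, s) -> y \in L (i, ~~ s) ->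
  (forall r, y \in L (turn r i, s) /\ c (turn r (turn r i), s) != y) -> False.
Proof.
move=> de bd be yb cw cv cside small_x dLx dLw yLv good.
have [c1 ex] := cside true; have [c0 e0] := cside false.
have [yL1 out1] := good true; have [yL0 out0] := good false.
have i1 : turn false (turn true i) = i by exact: (turnK true).
have i0 : turn true (turn false i) = i by exact: (turnK false).
have := turn_neq true i n_ge5; rewrite /= !inE !negb_or.
have dy : d != y by apply: contraNneq yb => <-.
have ey : e != y by apply: contraNneq yb => <-.
have xd : c (turn true (turn true i), ~~ s) != d.
  by apply: contraNneq small_x => ->.
set i2 := turn true (turn true i) in out1 small_x xd *.
set j2 := turn false (turn false i) in out0 *.
have ti : turn true (turn true i) = i2 by []; have tj : turn false (turn false i) = j2 by [].
clearbody i2 j2; move: ti tj i1 i0 c1 ex c0 e0 yL1 yL0 dLx.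
set i1 := turn true i; set i0 := turn false i => ti tj ri li c1 ex c0 e0 yL1 yL0 dLx.
have t1 : turn true i = i1 by []; have t0 : turn false i = i0 by [].
move=> /and5P[/and4P[a1 a2 a3 a4] /and3P[a5 a6 a7] /andP[a8 a9] a10 _].
have neq := (negPf a1, negPf a2, negPf a3, negPf a4, negPf a5, negPf a6,
  negPf a7, negPf a8, negPf a9, negPf a10).
have sneq : ((s == ~~ s) = false) * ((~~ s == s) = false) by case: (s).
set c' := recolor (recolor (recolor (recolor (recolor c (i, s) d)
  (i, ~~ s) y) (i0, s) y) (i1, s) y) (i1, ~~ s) d.
have col u : c' u = if u == (i1, ~~ s) then d else if u == (i1, s) then y
  else if u == (i0, s) then y else if u == (i, ~~ s) then y
  else if u == (i, s) then d else c u by [].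
(* Decides every equality between vertices of the five columns involved. *)
have pairs := (xpair_eqE, neq, eq_sym i1 i, eq_sym i0 i, eq_sym i2 i,
  eq_sym j2 i, eq_sym i0 i1, eq_sym i2 i1, eq_sym j2 i1, eq_sym i2 i0,
  eq_sym j2 i0, eq_sym j2 i2, sneq, eqxx, andbF, andbT).
apply: (no_smaller (c' := c')).
  apply: (proper_list_coloring_local (@prism_sym n) pc) => u.
  have [->|u1] := eqVneq u (i1, ~~ s).
    right; rewrite col eqxx; split=> // t /(prism_neighborP true) /=.
    rewrite ti ri negbK => -[] ->; rewrite col !pairs //; by rewrite eq_sym.
  have [->|u2] := eqVneq u (i1, s).
    right; rewrite col !pairs /=; split=> // t /(prism_neighborP true) /=.
    by rewrite ti ri => -[] ->; rewrite col !pairs.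
  have [->|u3] := eqVneq u (i0, s).
    right; rewrite col !pairs /=; split=> // t /(prism_neighborP true) /=.
    by rewrite tj li => -[] ->; rewrite col !pairs //= e0.
  have [->|u4] := eqVneq u (i, ~~ s).
    right; rewrite col !pairs /=; split=> // t /(prism_neighborP true) /=.
    by rewrite t1 t0 negbK => -[] ->; rewrite col !pairs //= e0.
  have [->|u5] := eqVneq u (i, s).
    right; rewrite col !pairs /=; split=> // t /(prism_neighborP true) /=.
    by rewrite t1 t0 => -[] ->; rewrite col !pairs //= eq_sym.
  by left; rewrite col (negPf u1) (negPf u2) (negPf u3) (negPf u4) (negPf u5).
move=> z.
have := card_recolor (recolor (recolor (recolor (recolor c (i, s) d)
  (i, ~~ s) y) (i0, s) y) (i1, s) y) (i1, ~~ s) d z.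
have := card_recolor (recolor (recolor (recolor c (i, s) d)
  (i, ~~ s) y) (i0, s) y) (i1, s) y z.
have := card_recolor (recolor (recolor c (i, s) d) (i, ~~ s) y) (i0, s) y z.
have := card_recolor (recolor c (i, s) d) (i, ~~ s) y z.
have := card_recolor c (i, s) d z.
rewrite -/c' cw [recolor _ _ _ (i, ~~ s)]/recolor [recolor _ _ _ (i0, s)]/recolor
  [recolor c _ _ (i0, s)]/recolor [recolor _ _ _ (i1, s)]/recolor.
rewrite [recolor _ _ _ (i1, s)]/recolor [recolor _ _ _ (i1, s)]/recolor.
rewrite ![recolor _ _ _ (i1, ~~ s)]/recolor !pairs cv c0 c1 ex.
have [->|zd] := eqVneq z d.
  rewrite (eq_sym y) (negPf dy) (eq_sym e) (negPf de) /=.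
  by have := big_le bd; count_lia.
have [->|ze] := eqVneq z e.
  rewrite (eq_sym y) (negPf ey) /=.
  by have := big_le be; count_lia.
have zb : ~~ big z.
  rewrite /big; move: bd be de zd ze; rewrite /big.
  by move=> /orP[]/eqP-> /orP[]/eqP->; rewrite ?eqxx // => _ /negPf-> /negPf->.
(* Even the gain of two for [y] keeps a class of size at most [m - 3] below [m]. *)
by have := small_le zb; case: (y == z) => /=; count_lia.
Qed.

Lemma big_pair x : big x -> exists y, [/\ big y, x != y &
  forall z, big z -> z != x -> z = y].
Proof.
case/orP=> /eqP->; [exists d2|exists d1].
  split=> // [|z /orP[]/eqP-> //]; first by rewrite /big eqxx orbT.
  by rewrite eqxx.
split=> // [||z /orP[]/eqP-> //]; first by rewrite /big eqxx.
  by rewrite eq_sym.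
by rewrite eqxx.
Qed.

(** This is what keeps a column with a single small vertex from having to pay both sides in the
    discharging. The lists around it are forced so far that [reduce_around_small] applies unless one
    column at distance two is entirely small. *)
Lemma small_between_full i s : ~~ big (c (i, s)) -> big (c (i, ~~ s)) ->
  (forall r t, big (c (turn r i, t))) ->
  exists r, forall t, ~~ big (c (turn r (turn r i), t)).
Proof.
move=> yb bd full; set y := c (i, s) in yb; set d := c (i, ~~ s) in bd.
have [e [be de only]] := big_pair bd.
have dy : d != y by apply: contraNneq yb => <-.
(* The two big colors alternate along adjacent big vertices, which fixes both side columns. *)
have cside r : c (turn r i, s) = d /\ c (turn r i, ~~ s) = e.
  have ce : c (turn r i, ~~ s) = e.
    by apply: only => //; rewrite eq_sym; exact: (pc.1 _ _ (prism_turn r i (~~ s))).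
  split=> //; have [x [_ _ onlyx]] := big_pair be.
  have {}onlyx z : big z -> z != e -> z = d.
    by move=> bz ze; rewrite (onlyx z) // -(onlyx d).
  by apply: onlyx => //; rewrite -ce; exact: (pc.1 _ _ (prism_rung _ s)).
have nbrX r u : prism (turn r i, ~~ s) u ->
    [\/ u = (turn r (turn r i), ~~ s), u = (i, ~~ s) | u = (turn r i, s)].
  by move/(prism_neighborP r); rewrite turnK negbK.
have nbrS r u : prism (turn r i, s) u ->
    [\/ u = (turn r (turn r i), s), u = (i, s) | u = (turn r i, ~~ s)].
  by move/(prism_neighborP r); rewrite turnK.
have small_out r : ~~ big (c (turn r (turn r i), ~~ s)).
  have [u /nbrX[]-> //] := big_has_small_neighbor (full r (~~ s)).
    by rewrite -/d bd.
  by rewrite (cside r).1 bd.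
have dLX r : d \in L (turn r i, ~~ s).
  have [z zL /andP[ze zr]] := card3_avoid e (c (turn r (turn r i), ~~ s)) (L3 (turn r i, ~~ s)).
  have [<- //|zd] := eqVneq z d.
  have zb : ~~ big z by apply/negP => /only /(_ zd) E; rewrite E eqxx in ze.
  have [u /nbrX[]-> E] := big_neighbor_colored (full r (~~ s)) zL zb.
  - by rewrite E eqxx in zr.
  - by rewrite -E eqxx in zd.
  - by rewrite -E (cside r).1 eqxx in zd.
have nbrV u : prism (i, ~~ s) u -> c u = e \/ u = (i, s).
  case/(prism_neighborP true)=> ->; rewrite ?(cside _).2 ?negbK; by [left|right].
have nbrW u : prism (i, s) u -> c u = d.
  by case/(prism_neighborP true)=> ->; rewrite ?(cside _).1.
have small_other z : z != d -> z != e -> ~~ big z.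
  by move=> zd ze; apply/negP => /only /(_ zd) E; rewrite E eqxx in ze.
have yLV : y \in L (i, ~~ s).
  have [z zL /andP[zd ze]] := card3_avoid d e (L3 (i, ~~ s)).
  have [u /nbrV[E|->] E'] := big_neighbor_colored bd zL (small_other _ zd ze).
    by rewrite -E' E eqxx in ze.
  by rewrite /y E'.
(* Here [y] is private to [(i, ~~ s)] and all neighbors of [(i, s)] have color [d], so any small
   list color other than [y] would be free at [(i, s)]. *)
have dLW : d \in L (i, s).
  have [z zL /andP[zy ze]] := card3_avoid y e (L3 (i, s)).
  have [<- //|zd] := eqVneq z d.
  have [||u /nbrW E E'] := private_neighbor_stuck (d := d) (v := (i, ~~ s))
    (ok := fun z => ~~ big z) (@prism_sym n) pc (fun c' z => @stuck d c' z bd)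
    erefl _ yLV _ zL zy zd (small_other _ zd ze).
  - by rewrite prism_sym prism_rung.
  - move=> u /nbrV[-> E|//]; by rewrite /y -E be in yb.
  - by rewrite -E' E eqxx in zd.
have not_good : ~ forall r,
    y \in L (turn r i, s) /\ c (turn r (turn r i), s) != y.
  exact: (reduce_around_small de bd be yb).
have [r bad] : exists r, ~~ ((y \in L (turn r i, s)) &&
    (c (turn r (turn r i), s) != y)).
  case: (boolP ((y \in L (turn true i, s)) && (c (turn true (turn true i), s) != y))).
    move=> /andP good1; exists false; apply/negP => /andP good0.
    by apply: not_good => -[].
  by exists true.
exists r => t; have [->|ts] := eqVneq t (~~ s); first exact: small_out.
have -> : t = s by move: ts; clear; case: t s => [] [].
(* If [y] is missing from the list of [(turn r i, s)], the small color this vertex must see is not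
   [y], so it lies in the outer column. *)
move: bad; rewrite negb_and negbK => /orP[yNL|/eqP->//].
have [z zL /andP[zd ze]] := card3_avoid d e (L3 (turn r i, s)).
have zb := small_other _ zd ze.
have [u /nbrS[]-> E] := big_neighbor_colored (full r s) zL zb.
- by rewrite E.
- by rewrite -/y in E; rewrite E zL in yNL.
- by rewrite -E (cside r).2 eqxx in ze.
Qed.

Definition small_count (i : 'I_n) : nat := ~~ big (c (i, false)) + ~~ big (c (i, true)).

Lemma small_count_eq0 i : small_count i = 0 -> forall t, big (c (i, t)).
Proof. by rewrite /small_count => H []; move: H; do 2!case: big. Qed.

Lemma small_count_eq2 i : (forall t, ~~ big (c (i, t))) -> small_count i = 2.
Proof. by move=> H; rewrite /small_count !H. Qed.

Lemma small_count_eq1 i : small_count i = 1 ->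
  exists2 s, ~~ big (c (i, s)) & big (c (i, ~~ s)).
Proof.
rewrite /small_count; case b0 : big; case b1 : big => // _.
  by exists true; rewrite /= ?b0 ?b1.
by exists false; rewrite /= ?b0 ?b1.
Qed.

(** Both vertices of the middle column need a small neighbor, and only the remaining side can supply
    one. *)
Lemma full_full r i : small_count i = 0 -> small_count (turn r i) = 0 ->
  small_count (turn (~~ r) i) = 2.
Proof.
move=> /small_count_eq0 full /small_count_eq0 fullr; apply: small_count_eq2 => t.
have [u /(prism_neighborP r)[]-> //] := big_has_small_neighbor (full t).
  by rewrite fullr.
by rewrite full.
Qed.

(* Discharging, in units of a third: a column starts with charge
   [3 * small_count i - 2], and [give r i] is what column [i] sends to its
   neighbour in direction [r]. *)
Definition give r i : nat :=
  if small_count i == 2 then 2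
  else (small_count i == 1) && (small_count (turn r i) == 0) &&
       (small_count (turn r (turn r i)) != 2).

(** Negative terms are moved across to stay in [nat]. The initial charges are 4, 1 and -2 for
    columns with 2, 1 and 0 small vertices. *)
Lemma final_charge_ge0 i : give true i + give false i + 2 <=
  3 * small_count i + give true (turn false i) + give false (turn true i).
Proof.
have le2 j : small_count j <= 2 by rewrite /small_count; do 2!case: big.
have := le2 i; rewrite leq_eqVlt => /predU1P[E|].
  by rewrite {1 2}/give E eqxx; lia.
rewrite ltnS leq_eqVlt => /predU1P[E|].
  (* With charge 1 the column can pay one neighbor only; paying both would contradict
     [small_between_full]. *)
  have not_both : [|| small_count (turn true i) != 0, small_count (turn false i) != 0,
      small_count (turn true (turn true i)) == 2 |
      small_count (turn false (turn false i)) == 2].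
    apply/or4P; have [E1|] := eqVneq (small_count (turn true i)) 0; last by constructor 1.
    have [E0|] := eqVneq (small_count (turn false i)) 0; last by constructor 2.
    have [s sm bg] := small_count_eq1 E.
    have [[] /small_count_eq2 ->] := small_between_full sm bg
      (fun r => match r with true => small_count_eq0 E1 | false => small_count_eq0 E0 end).
      by constructor 3.
    by constructor 4.
  rewrite {1 2}/give E /=; move: not_both.
  by do 4!case: (_ == _) => //=; lia.
(* An empty column needs 2: if a neighbor is also empty, the opposite one is entirely small and
   sends 2; otherwise it gets 2 from one neighbor or 1 from each. *)
rewrite ltnS leqn0 => /eqP E; rewrite /give E /=.
rewrite (turnK true) (turnK false) E /=.
have H1 : small_count (turn true i) = 0 -> small_count (turn false i) = 2.
  exact: full_full E.
have H0 : small_count (turn false i) = 0 -> small_count (turn true i) = 2.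
  exact: full_full E.
move: H1 H0 (le2 (turn true i)) (le2 (turn false i)).
move: (small_count (turn true i)) (small_count (turn false i)); clear.
by move=> [|[|[|p]]] [|[|[|q]]] //=; lia.
Qed.

Lemma two_large_classes_small :
  3 * (#|color_class c d1| + #|color_class c d2|) <= 4 * n.
Proof.
have shift r h : \sum_i h (turn (n := n) r i) = \sum_i h i :> nat.
  by rewrite [RHS](reindex_inj (can_inj (turnK r))).
have discharge (f g h : 'I_n -> nat) :
    (forall i, f i + g i + 2 <= 3 * h i + f (turn false i) + g (turn true i)) ->
    2 * n <= 3 * \sum_i h i.
  move=> le; have : \sum_i (f i + g i + 2) <=
      \sum_i (3 * h i + f (turn false i) + g (turn true i)) by apply: leq_sum.
  rewrite 4!big_split /= (shift false f) (shift true g) -big_distrr /=.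
  rewrite sum_nat_const card_ord.
  by move: (\sum_i f i) (\sum_i g i) (\sum_i h i); clear; lia.
have charge := discharge _ _ _ final_charge_ge0.
have total : #|color_class c d1| + #|color_class c d2| + \sum_i small_count i = 2 * n.
  rewrite (card_columns (fun v => c v == d1)) (card_columns (fun v => c v == d2)).
  have -> : 2 * n = \sum_(i < n) 2 by rewrite sum_nat_const card_ord mulnC.
  rewrite -!big_split /=.
  apply: eq_bigr => i _; rewrite /small_count /big.
  have one x : (x == d1) + (x == d2) + ~~ ((x == d1) || (x == d2)) = 1.
    by have [->|_] := eqVneq x d1; [rewrite (negPf d12)|case: eqP].
  have := one (c (i, false)); have := one (c (i, true)); count_lia.
lia.
Qed.

End TwoLargeClasses.

(** * The 3-coloring of period 3 and the case analysis on class sizes *)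

Lemma sum_color_classes_le (V : finType) (C : choiceType) (c : V -> C) (s : seq C) :
  uniq s -> \sum_(x <- s) #|color_class c x| <= #|V|.
Proof.
move=> s_uniq.
rewrite (eq_bigr (fun x => \sum_v (c v == x))); last first.
  move=> x _; rewrite -sum1_card big_mkcond /=; apply: eq_bigr => v _.
  by rewrite inE; case: eqP.
rewrite exchange_big -sum1_card /=; apply: leq_sum => v _.
rewrite -big_mkcond /= sum1_count.
rewrite (eq_count (a2 := pred1 (c v))); last by move=> x; rewrite /= eq_sym.
by rewrite count_uniq_mem // leq_b1.
Qed.

(** Color [(i, s)] by [i + s] modulo 3. This closes up around the cycle because 3 divides [n], and
    any three consecutive columns use each color twice. *)
Lemma exists_three_coloring n k (C : choiceType) (a b y : C) : n = 3 * k ->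
  uniq [:: a; b; y] -> exists c : 'I_n * bool -> C,
    [/\ proper_coloring (@prism n) c,
        forall v, c v \in [:: a; b; y] &
        forall x, #|color_class c x| <= 2 * k].
Proof.
move=> -> aby; pose f j := nth a [:: a; b; y] (j %% 3).
exists (fun v : 'I_(3 * k) * bool => f (v.1 + v.2)); split.
- move=> [i s] u /(prism_neighborP true) iu.
  rewrite /f /= nth_uniq //= ?ltn_mod //.
  case: iu => -> /=.
  + have := val_turn true i; rewrite /= => ->; have := ltn_ord i; case: (_.+1 =P _); case: (s); lia.
  + have := val_turn false i; rewrite /= => ->; have := ltn_ord i; case: (_ =P 0); case: (s); lia.
  + by case: (s) => /=; lia.
- by move=> v; rewrite mem_nth // ltn_mod.
- move=> x; rewrite card_columns /=.
  rewrite -(big_mkord xpredT (fun i => (f (i + 0) == x) + (f (i + 1) == x))).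
  elim: k => [|k IHk]; first by rewrite big_geq.
  rewrite mulnS [3 + _]addnC !addnS addn0 !big_nat_recr //=.
  have le2 : (a == x) + (b == x) + (y == x) <= 1.
    have := count_uniq_mem x aby; rewrite /= ; case: (x \in _); lia.
  have -> : f (3 * k + 0) = a by rewrite /f; have -> : (3 * k + 0) %% 3 = 0 by lia.
  have -> : f (3 * k + 1) = b by rewrite /f; have -> : (3 * k + 1) %% 3 = 1 by lia.
  have -> : f ((3 * k).+1 + 0) = b.
    by rewrite /f; have -> : ((3 * k).+1 + 0) %% 3 = 1 by lia.
  have -> : f ((3 * k).+1 + 1) = y.
    by rewrite /f; have -> : ((3 * k).+1 + 1) %% 3 = 2 by lia.
  have -> : f ((3 * k).+2 + 0) = y.
    by rewrite /f; have -> : ((3 * k).+2 + 0) %% 3 = 2 by lia.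
  have -> : f ((3 * k).+2 + 1) = a.
    by rewrite /f; have -> : ((3 * k).+2 + 1) %% 3 = 0 by lia.
  by move: IHk le2; count_lia.
Qed.

Lemma other_color_improves (V : finType) (C : choiceType) (e : rel V)
    (L : V -> {fset C}) (c : V -> C) v z :
  symmetric e -> lex_min_coloring e L c ->
  z \in L v -> z \notin codom c -> #|color_class c (c v)| <= 1.
Proof.
move=> e_sym cmin zL znew; have pc := cmin.1.
rewrite leqNgt; apply/negP => gt1.
have zv u : c u != z by apply: contraNneq znew => <-; exact: codom_f.
have z0 : #|color_class c z| = 0.
  by apply/eqP; rewrite -leqn0 leqNgt color_class_gt0.
apply: (lex_min_dominated (t := #|color_class c (c v)|) (c' := recolor c v z)
          (a := c v) cmin).
- apply: (proper_list_coloring_local e_sym pc) => u; rewrite {1 2}/recolor.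
  case: eqP => [->|]; [right; split=> // t vt|by left].
  rewrite /recolor eqxx; case: (t =P v) => [tv|//].
  by have := pc.1 _ _ vt; rewrite tv eqxx.
- move=> x; have := card_recolor c v z x.
  have [<-|_] := eqVneq z x; last by rewrite /=; lia.
  rewrite (negPf (zv v)) z0 /=; lia.
- have := card_recolor c v z (c v).
  by rewrite eqxx eq_sym (negPf (zv v)) /=; lia.
Qed.

Theorem theorem4p10 (n : nat) (C : choiceType)
    (L : 'I_n * bool -> {fset C}) (c : 'I_n * bool -> C) :
  6 <= n ->
  uniform_list_assignment 3 L ->
  lex_min_coloring (@prism n) L c ->
  bounded_coloring (ceil_divn (2 * n) 3) c.
Proof.
move=> n_ge6 L3 cmin a0; have pc := cmin.1; rewrite leqNgt; apply/negP => a0_large.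
have n_ge5 : 5 <= n by lia.
have size_max x : #|color_class c x| <= \max_v #|color_class c (c v)|.
  have [/codomP[v ->]|] := boolP (x \in codom c).
    exact: (leq_bigmax (F := fun v => #|color_class c (c v)|)).
  by rewrite -color_class_gt0 -leqNgt leqn0 => /eqP ->.
have V_gt0 : 0 < #|{: 'I_n * bool}| by rewrite card_prod card_ord card_bool; lia.
have [v0 v0_max] := eq_bigmax (fun v => #|color_class c (c v)|) V_gt0.
move: size_max; rewrite v0_max; set a := c v0; set m := #|color_class c a| => size_max.
(* [m] exceeds the rounded-up value of 2n/3 by at least one, hence the 3. *)
have m_large : 2 * n + 3 <= 3 * m.
  by have := leq_trans a0_large (size_max a0); rewrite /ceil_divn; lia.
have card_V : #|{: 'I_n * bool}| = 2 * n by rewrite card_prod card_ord card_bool mulnC.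
have size_gt0 x : 0 < #|color_class c x| -> exists v, c v = x.
  by rewrite color_class_gt0 => /codomP[v ->]; exists v.
have [/existsP[v1 /andP[ba b_large]]|no_b] :=
    boolP [exists v, (c v != a) && (m <= #|color_class c (c v)| + 1)]; last first.
  have others x : x != a -> #|color_class c x| + 2 <= m.
    move=> xa; have [x0|/size_gt0[v cv]] := posnP #|color_class c x|.
      by rewrite x0; lia.
    by have /existsPn/(_ v) := no_b; rewrite cv xa -ltnNge /=; lia.
  suff : 3 * m <= 2 * n by lia.
  apply: (stuck_class_small n_ge5 L3 pc) => c' z pc' za dom lt_a.
  apply: (lex_min_dominated (t := m) (a := a) cmin pc').
    move=> x; have := dom x; have [->|xa] := eqVneq x a; first by lia.
    by have := others x xa; case: (x == z); lia.
  by rewrite lt_a /=.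
set b := c v1 in ba b_large.
have b_le := size_max b.
have [/existsP[v2 /and3P[ya yb y_large]]|no_y] :=
    boolP [exists v, [&& c v != a, c v != b & m <= #|color_class c (c v)| + 2]].
  set y := c v2 in ya yb y_large.
  have aby : uniq [:: a; b; y].
    by rewrite /= !inE negb_or (eq_sym a b) (eq_sym a y) (eq_sym b y) ba ya yb.
  (* The sizes are at least m, m - 1 and m - 2, with sum at least 3m - 3, hence at least 2n. So
     equality holds: no other color occurs, and 3 divides [n]. *)
  have sum3 := sum_color_classes_le c aby.
  rewrite !big_cons big_nil card_V in sum3.
  have onto v : c v \in [:: a; b; y].
    apply/negPn/negP => vout.
    have := @sum_color_classes_le _ _ c (c v :: [:: a; b; y]).
    rewrite [uniq _]/= vout => /(_ aby); rewrite !big_cons big_nil card_V.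
    have : 0 < #|color_class c (c v)| by rewrite color_class_gt0 codom_f.
    by move: sum3 b_large y_large m_large; rewrite -/m; clear; lia.
  have size_ge v : 1 < #|color_class c (c v)|.
    have := onto v; rewrite !inE => /or3P[]/eqP->; rewrite -?/m; lia.
  have lists v : {subset [:: a; b; y] <= L v}.
    have sub : {subset enum_fset (L v) <= [:: a; b; y]}.
      move=> z zL; have [/codomP[u ->]//|znew] := boolP (z \in codom c).
      by have := other_color_improves (@prism_sym n) cmin zL znew; rewrite leqNgt size_ge.
    have [_ E] := uniq_min_size (fset_uniq (L v)) sub (eq_leq (esym (L3 v))).
    by move=> z; rewrite -E.
  have n3 : n = 3 * (n %/ 3) by move: sum3 b_large y_large m_large; rewrite -/m; clear; lia.
  have [c' [pc' c'_in c'_le]] := exists_three_coloring n3 aby.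
  apply: (lex_min_dominated (t := m) (a := a) (c' := c') cmin).
  - by split=> // v; apply: lists.
  - by move=> x; have := c'_le x; lia.
  - by have := c'_le a; rewrite leqnn andbT; lia.
have small x : ~~ big a b x -> #|color_class c x| + 3 <= m.
  rewrite negb_or => /andP[xa xb].
  have [x0|/size_gt0[v cv]] := posnP #|color_class c x|; first by rewrite x0; lia.
  by have /existsPn/(_ v) := no_y; rewrite cv xa xb -ltnNge /=; lia.
(* As the class of [b] has size at least m - 1, the left side is at least 6m - 3, hence at least 4n
   + 3. *)
suff : 3 * (m + #|color_class c b|) <= 4 * n by lia.
have ab : a != b by rewrite eq_sym.
apply: (two_large_classes_small n_ge5 L3 pc (m := m) ab _ (fun x _ => size_max x) small).
- move=> d c' z bd pc' zd zsmall dom lt_d.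
  have d_large : m <= #|color_class c d| + 1.
    by case/orP: bd => /eqP->; rewrite // -/m leq_addr.
  (* The threshold is at least m - 1, while a small class that gains a vertex has size at most m -
     2. *)
  apply: (lex_min_dominated (t := #|color_class c d|) (a := d) cmin pc').
    move=> x; have := dom x; have [->|xz] := eqVneq x z; last by rewrite addn0.
    by have := small z zsmall; lia.
  by rewrite lt_d leqnn.
- move=> c' pc' lt_m; apply: (lex_min_dominated (t := m) (a := a) cmin pc').
    by move=> x; have := lt_m x; lia.
  by rewrite lt_m leqnn.
Qed.
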